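(* Let $\mathbb M^3(c)$ be one of the standard models $\mathbb R^3$, $\mathbb S^3(c)$, $\mathbb H^3(-c)$ of the real space forms, and let $\gamma\subset\mathbb M^3(c)$ be an arc length parametrized Frenet curve with nonzero torsion and principal normal $N$. Then $\gamma$ lies on a geodesic sphere of $\mathbb M^3(c)$ if and only if there is a unit concircular vector field $\mathcal V$ along $\gamma$ with potential function $$f=\frac{1}{a\tan\theta+b},$$ where $\theta=\cos^{-1}(\langle\mathcal V,N\rangle)$ and $a,b\in\mathbb R$ are constants (the right-hand side being required to be defined along $\gamma$).
   Context: $\mathbb S^3(c)\subset\mathbb R^4$ is the round sphere of radius $c>0$ centered at the origin, and $\mathbb H^3(-c)\subset\mathbb R^4_1$ is the analogous hyperboloid model of hyperbolic space (of curvature $-1/c^2$) in Lorentz–Minkowski space $\mathbb R^4_1$. Geodesic spheres: in $\mathbb R^3$ these are the standard round spheres; in $\mathbb M^3(c)$ geodesic spheres are totally umbilical surfaces, and in $\mathbb S^3(c)\subset\mathbb R^4$ and $\mathbb H^3(-c)\subset\mathbb R^4_1$ they are obtained as intersections of these hypersurfaces with (affine) hyperplanes. Frenet curve in a Riemannian $3$-manifold ($\nabla$ the Levi-Civita connection): a smooth curve with $\gamma',\nabla_{\gamma'}\gamma',\nabla_{\gamma'}^2\gamma'$ linearly independent along the parameter interval. When parametrized by arc length it has a positively oriented orthonormal Frenet frame $\{T=\gamma',N,B\}$ and curvatures $\kappa=\kappa_1>0$, $\tau=\kappa_2>0$ with $\nabla_TT=\kappa N$, $\nabla_TN=-\kappa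 T+\tau B$, $\nabla_TB=-\tau N$; $\tau$ is the torsion. Concircular along $\gamma$: a vector field $\mathcal V$ along $\gamma$ is concircular along $\gamma$ with potential function $f$ (a smooth function on the parameter interval) if $\nabla_T\mathcal V=fT$. Unit means $|\mathcal V|=1$ along $\gamma$. *)

(* Defs.v *)
From HB Require Import structures.
From mathcomp Require Import all_boot all_order all_algebra.
From mathcomp Require Import all_classical all_reals all_analysis.

Set Implicit Arguments.
Unset Strict Implicit.
Unset Printing Implicit Defensive.

Import Order.TTheory GRing.Theory Num.Theory.
Import numFieldNormedType.Exports.

Local Open Scope ring_scope.
Local Open Scope classical_set_scope.

(* [Sphere] and [Hyperboloid] stand for S^3(c) in R^4 and H^3(-c) in R^4_1;
   the positive parameter [c] is passed separately and is ignored by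
   [Euclid], which stands for R^3. *)
Variant model := Euclid | Sphere | Hyperboloid.

Definition pred_dim (M : model) : nat :=
  match M with Euclid => 2 | Sphere | Hyperboloid => 3 end.

Notation ambient R M := 'rV[R]_(pred_dim M).+1.

Section SpaceForms.
Context {R : realType}.

(* In R^4_1 the coordinate of index 0 is the time-like one. *)
Definition signature (M : model) (i : 'I_(pred_dim M).+1) : R :=
  match M with
  | Hyperboloid => if val i == 0%N then -1 else 1
  | _ => 1
  end.

Definition ip (M : model) (u v : ambient R M) : R :=
  \sum_(i < (pred_dim M).+1) signature i * u 0 i * v 0 i.

Definition space_form (M : model) (c : R) : set (ambient R M) :=
  match M return set (ambient R M) with
  | Euclid => setT
  | Sphere => [set x | ip x x = c ^+ 2]
  | Hyperboloid => [set x | ip x x = - c ^+ 2 /\ 0 < x 0 0]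
  end.

Definition tangent (M : model) (x : ambient R M) : set (ambient R M) :=
  match M return ambient R M -> set (ambient R M) with
  | Euclid => fun=> setT
  | _ => fun x => [set v | ip x v = 0]
  end x.

(* Orthogonal projection of the ambient space onto [tangent x]; the position
   vector [x] is normal to both hyperquadrics. *)
Definition tangent_proj (M : model) (x v : ambient R M) : ambient R M :=
  match M with
  | Euclid => v
  | _ => v - (ip v x / ip x x) *: x
  end.

(* Covariant derivative along [gamma]: the Levi-Civita connection of a
   submanifold with the induced metric is the tangential part of the
   flat ambient derivative. *)
Definition covd (M : model) (gamma V : R -> ambient R M) : R -> ambient R M :=
  fun t => tangent_proj (gamma t) (derive1 V t).

Definition smooth_on (W : normedModType R) (I : set R) (F : R -> W) : Prop :=
  forall (n : nat) (t : R), I t -> derivable (derive1n n F) t 1.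

Definition open_interval (I : set R) : Prop :=
  [/\ open I, is_interval I & I !=set0].

Definition curve_in (M : model) (c : R) (I : set R)
    (gamma : R -> ambient R M) : Prop :=
  smooth_on I gamma /\ forall t, I t -> space_form c (gamma t).

Definition field_along (M : model) (I : set R)
    (gamma V : R -> ambient R M) : Prop :=
  smooth_on I V /\ forall t, I t -> tangent (gamma t) (V t).

Definition arc_length (M : model) (I : set R)
    (gamma : R -> ambient R M) : Prop :=
  forall t, I t -> ip (derive1 gamma t) (derive1 gamma t) = 1.

Definition frenet_curve (M : model) (c : R) (I : set R)
    (gamma : R -> ambient R M) : Prop :=
  curve_in c I gamma /\
  forall t, I t ->
    free [:: derive1 gamma t;
             covd gamma (derive1 gamma) t;
             covd gamma (covd gamma (derive1 gamma)) t].

Definition orthonormal (M : model) (u v w : ambient R M) : Prop :=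
  [/\ ip u u = 1, ip v v = 1 & ip w w = 1] /\
  [/\ ip u v = 0, ip u w = 0 & ip v w = 0].

(* The hyperquadrics are oriented by the normal field given by the position
   vector, placed first. *)
Definition positively_oriented (M : model) (x u v w : ambient R M) : Prop :=
  match M return ambient R M -> ambient R M -> ambient R M -> ambient R M
                 -> Prop with
  | Euclid => fun _ u v w =>
      0 < \det (\matrix_(i < 3) nth 0 [:: u; v; w] i)
  | _ => fun x u v w =>
      0 < \det (\matrix_(i < 4) nth 0 [:: x; u; v; w] i)
  end x u v w.

(* As the frame is positively oriented, [tau] may have either sign. *)
Definition frenet_apparatus (M : model) (I : set R)
    (gamma T N B : R -> ambient R M) (kappa tau : R -> R) : Prop :=
  [/\ field_along I gamma T, field_along I gamma N & field_along I gamma B] /\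
  forall t, I t ->
    [/\ T t = derive1 gamma t,
        orthonormal (T t) (N t) (B t) &
        positively_oriented (gamma t) (T t) (N t) (B t)] /\
    [/\ 0 < kappa t,
        covd gamma T t = kappa t *: N t,
        covd gamma N t = - kappa t *: T t + tau t *: B t &
        covd gamma B t = - tau t *: N t].

Definition concircular (M : model) (I : set R)
    (gamma V : R -> ambient R M) (f : R -> R) : Prop :=
  [/\ field_along I gamma V, smooth_on I f &
      forall t, I t -> covd gamma V t = f t *: derive1 gamma t].

Definition unit_along (M : model) (I : set R) (V : R -> ambient R M) : Prop :=
  forall t, I t -> ip (V t) (V t) = 1.

(* In the hyperquadrics: any intersection with an affine hyperplane
   {x | <p, x> = d} (every affine hyperplane has this form, <,> being
   nondegenerate) that is a surface. Such an intersection is either a surface,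
   a single point or empty, hence the last condition. In the hyperboloid this
   covers all the totally umbilical surfaces, horospheres and equidistant
   surfaces included. *)
Definition geodesic_sphere (M : model) (c : R) (S : set (ambient R M)) : Prop :=
  match M return set (ambient R M) -> Prop with
  | Euclid => fun S => exists (m : ambient R Euclid) (r : R),
      0 < r /\ S = [set x | ip (x - m) (x - m) = r ^+ 2]
  | M' => fun S => exists (p : ambient R M') (d : R),
      [/\ p != 0,
          S = space_form c `&` [set x | ip p x = d] &
          exists x y, [/\ S x, S y & x <> y]]
  end S.

End SpaceForms.

(* Main.v *)
Require Import Defs.
From mathcomp Require Import all_boot all_order all_algebra.
From mathcomp Require Import all_classical all_reals all_analysis.
From mathcomp Require Import ring lra.

Import Order.TTheory GRing.Theory Num.Theory.
Import numFieldNormedType.Exports.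
Local Open Scope ring_scope.
Local Open Scope classical_set_scope.

(** A curve lies on a geodesic sphere exactly when some vector field of the
    form [alpha *: gamma + m], with [alpha != 0] and [m] a constant vector of
    the ambient space, is tangent to the space form and normal to the curve.
    In R^3 this is the radius vector from the centre; in the hyperquadrics it
    is the tangential part of the normal vector of the hyperplane.  Its
    covariant derivative is [alpha *: T], so that it is concircular, and it has
    constant length.

    From a sphere to a concircular field ([concircular_of_sphere]): normalize
    that field.  Its potential function is then constant, so [a = 0] and
    [b = 1 / f].  The constant [alpha] vanishes only for a hyperplane through
    the origin; the field would then be parallel and normal to the curve, and
    the Frenet equations, with [kappa] and [tau] nonzero, make such a field zero
    ([normal_parallel_eq0]).

    From a concircular field to a sphere ([sphere_of_concircular]):
    differentiating [<V, V> = 1] gives [V] normal to [T], hence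
    [V = p N + q B] with [p' = tau q], [q' = - tau p] and [f = - kappa p].  As
    [theta] takes values in [[0, pi]], [tan theta = |q| / p], and the
    hypothesis reads [- 1 / kappa = a |q| + b p].  The absolute value is
    harmless: [a |q|] is differentiable whereas [q] has only simple zeros, so
    that either [a = 0] or [q] has no zero, and in both cases [a |q| = h q] for
    a constant [h] ([norm_eq_cst_mul]).  Thus [rho = 1 / kappa] is a combination
    of [p] and [q] with constant coefficients, and with [sigma = h p - b q] the
    pair [(rho, sigma)] satisfies the same rotation equations as [(p, q)].
    Therefore [W = rho N + sigma B] has derivative [- T] in the ambient space,
    [W + gamma] is constant, and this constant is the centre of the sphere,
    respectively the normal vector of the hyperplane ([sphere_of_center]). *)

(** * Calculus on an open interval *)

Set Implicit Arguments.
Unset Strict Implicit.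
Unset Printing Implicit Defensive.

Lemma is_derive_mxP {R : realFieldType} {V : normedModType R} {m n : nat}
    (F : V -> 'M[R]_(m, n)) (t v : V) (dF : 'M[R]_(m, n)) :
  is_derive t v F dF <->
  forall i j, is_derive t v (fun x => F x i j) (dF i j).
Proof.
split=> [[Ft <-] i j|dFt].
  rewrite derive_mx // mxE; apply: DeriveDef => //.
  by move: i j; apply/derivable_mxP.
have Ft : derivable F t v by apply/derivable_mxP => i j; case: (dFt i j).
apply: DeriveDef => //; rewrite derive_mx //.
by apply/matrixP => i j; rewrite mxE; case: (dFt i j).
Qed.

Lemma is_derive_scale {R : realFieldType} {m n : nat} (k : R -> R)
    (F : R -> 'M[R]_(m, n)) (t dk : R) (dF : 'M[R]_(m, n)) :
  is_derive t 1 k dk -> is_derive t 1 F dF ->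
  is_derive t 1 (fun x => k x *: F x) (dk *: F t + k t *: dF).
Proof.
move=> kt /is_derive_mxP Ft; apply/is_derive_mxP => i j.
rewrite (_ : (fun x => (k x *: F x) i j) = k * (fun x => F x i j)); last first.
  by apply/funext => x; rewrite mxE.
have Ftij := Ft i j; apply: is_derive_eq.
by rewrite !mxE /= addrC; congr (_ + _); exact: mulrC.
Qed.

Lemma near_open {R : realType} (I : set R) (P : R -> Prop) (t : R) :
  open I -> I t -> (forall x, I x -> P x) -> \forall x \near t, P x.
Proof.
by move=> oI It IP; apply: filterS IP _; exact: open_nbhs_nbhs.
Qed.

Lemma is_derive_cst_on {R : realType} {W : normedModType R} (I : set R)
    (f : R -> W) (w : W) (t : R) :
  open I -> I t -> (forall x, I x -> f x = w) -> is_derive t 1 f 0.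
Proof.
move=> oI It fw; apply: (near_eq_is_derive (f := cst w)).
by apply: near_open It _ => // x Ix; rewrite fw.
Qed.

Lemma derive_cst_on {R : realType} {W : normedModType R} (I : set R)
    (f : R -> W) (w df : W) (t : R) :
  open I -> I t -> (forall x, I x -> f x = w) -> is_derive t 1 f df -> df = 0.
Proof.
by move=> oI It /(is_derive_cst_on oI It)[_ <-] [_ <-].
Qed.

Lemma is_derive0_cst {R : realType} (I : set R) (f : R -> R) :
  is_interval I -> (forall t, I t -> is_derive t 1 f 0) ->
  forall x y, I x -> I y -> f x = f y.
Proof.
move=> iI f0 x y; wlog xy : x y / x <= y.
  by move=> H Ix Iy; case: (leP x y) => [/H|/ltW /H]; [apply|move=> ->].
move=> Ix Iy.
have fI z : z \in `[x, y]%R -> I z by rewrite in_itv; apply: iI.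
have [z||z _] := @MVT_segment R f (fun=> 0) x y xy.
- move=> zxy; apply/f0/fI; move: zxy.
  by rewrite !in_itv /= => /andP[/ltW -> /ltW ->].
- by apply: derivable_within_continuous => z /fI /f0 [].
- by rewrite mul0r => /eqP; rewrite subr_eq0 => /eqP ->.
Qed.

Lemma is_derive0_cst_mx {R : realType} {m n : nat} (I : set R)
    (F : R -> 'M[R]_(m, n)) :
  is_interval I -> (forall t, I t -> is_derive t 1 F 0) ->
  forall x y, I x -> I y -> F x = F y.
Proof.
move=> iI F0 x y Ix Iy; apply/matrixP => i j.
apply: (is_derive0_cst (f := fun t => F t i j) iI) => // t It.
by have /is_derive_mxP/(_ i j) := F0 t It; rewrite mxE.
Qed.

Lemma smooth_on_affine {R : realType} {W : normedModType R} (I : set R)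
    (F : R -> W) (k : R) (w : W) :
  open I -> smooth_on I F -> smooth_on I (fun t => k *: F t + w).
Proof.
move=> oI sF n.
have step m t : I t ->
    derive1n m (fun t => k *: F t + w) t
    = k *: derive1n m F t + (if m is 0 then w else 0).
  elim: m t => [//|m IH] t It; rewrite !derive1nS !derive1E.
  have Fm := derivableP (sF m t It).
  rewrite (near_eq_derive _ (near_open oI It IH)) addr0.
  apply: (@derive_val _ _ _ _ _ (k \*: derive1n m F + cst _)).
  by apply: is_derive_eq; rewrite addr0.
move=> t It; apply: (@near_eq_derivable _ _ _ (k \*: derive1n n F + cst _)).
  by apply: near_open It _ => // x Ix; rewrite step.
by apply: derivableD; [apply/derivableZ/sF|exact: derivable_cst].
Qed.

Lemma smooth_on_cst {R : realType} {W : normedModType R} (I : set R) (w : W) :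
  smooth_on I (cst w).
Proof.
move=> n t It; suff [v ->] : exists v, derive1n n (cst w) = cst v.
  exact: derivable_cst.
elim: n => [|n [v IH]]; first by exists w.
by exists 0; rewrite derive1nS IH; apply/funext => x; rewrite derive1_cst.
Qed.

(** Such a [t] is an interior minimum of [f]. *)
Lemma is_derive_nonneg0 {R : realType} (I : set R) (f : R -> R) (t : R) :
  open I -> I t -> (forall x, I x -> derivable f x 1) ->
  (forall x, I x -> 0 <= f x) -> f t = 0 -> is_derive t 1 f 0.
Proof.
move=> oI It df f0 ft; have /nbhs_ballP[e /= e0 teI] := open_nbhs_nbhs (conj oI It).
have eI x : x \in `]t - e, t + e[%R -> I x.
  by rewrite in_itv /= => xe; apply: teI; rewrite /ball /= distrC ltr_distl.
apply: (@derive1_at_min _ f (t - e) (t + e)).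
- lra.
- by move=> x /eI; exact: df.
- by rewrite in_itv /=; apply/andP; split; lra.
- by move=> x /eI Ix; rewrite ft f0.
Qed.

(** At a zero [t] of [q] with [a != 0], the functions [|q| - q] and [|q| + q]
    are differentiable and minimal, so [q' t = 0], which is excluded.  So if
    [a != 0] then [q] has no zero and [a |q| / q] is a differentiable function with constant square. *)
Lemma norm_eq_cst_mul {R : realType} (I : set R) (q dq : R -> R) (a : R) :
  open_interval I ->
  (forall t, I t -> is_derive t 1 q (dq t)) -> (forall t, I t -> dq t != 0) ->
  (forall t, I t -> derivable (fun x => a * `|q x|) t 1) ->
  exists h, forall t, I t -> a * `|q t| = h * q t.
Proof.
case=> oI iI [t0 It0] dqI dq0 aqI.
have [->|a0] := eqVneq a 0; first by exists 0 => t It; rewrite !mul0r.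
have nqI t : I t -> derivable (fun x => `|q x|) t 1.
  move=> It; rewrite (_ : (fun x => _) = a^-1 \*: (fun x => a * `|q x|)).
    exact/derivableZ/aqI.
  by apply/funext => x; exact/esym/(mulKf a0).
have q0 t : I t -> q t != 0.
  move=> It; apply/eqP => qt; have /negP := dq0 t It; apply.
  have dqt := dqI t It.
  have [dn dnt] : exists dn : R, is_derive t 1 (fun x : R => `|q x|) dn.
    by exists ('D_1 (fun x : R => `|q x|) t); exact/derivableP/nqI.
  have /(@derive_val _ _ _ _ _ _ _) : is_derive t 1 ((fun x => `|q x|) - q) 0.
    apply: (is_derive_nonneg0 oI It) => [x Ix|x Ix|].
    - by apply: derivableB; [exact: nqI|case: (dqI x Ix)].
    - by rewrite /= subr_ge0 ler_norm.
    - by rewrite -[LHS]/(`|q t| - q t) qt normr0 subr0.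
  have /(@derive_val _ _ _ _ _ _ _) : is_derive t 1 ((fun x => `|q x|) + q) 0.
    apply: (is_derive_nonneg0 oI It) => [x Ix|x Ix|].
    - by apply: derivableD; [exact: nqI|case: (dqI x Ix)].
    - by rewrite /= -lerBlDr sub0r -normrN ler_norm.
    - by rewrite -[LHS]/(`|q t| + q t) qt normr0 addr0.
  rewrite !derive_val => /= e1 e2; apply/eqP.
  by move: e1 e2; clear; lra.
have hI t : I t -> is_derive t 1 (fun x => a * `|q x| / q x) 0.
  move=> It; have dqt := dqI t It.
  have dh : derivable (fun x => a * `|q x| / q x) t 1.
    apply: (derivableM (f := fun x => a * `|q x|) (g := fun x => (q x)^-1)).
      exact: aqI.
    by apply: derivableV; [exact: q0|case: dqt].
  apply: DeriveDef => //; set u := (fun x => _) in dh *.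
  have u2 x : I x -> (u * u) x = a ^+ 2.
    move=> Ix; rewrite -[LHS]/(u x * u x) -expr2 !exprMn exprVn.
    by rewrite real_normK ?num_real // mulfK // expf_neq0 // q0.
  have du := derivableP dh.
  have /eqP := derive_cst_on oI It u2 (is_deriveM du du).
  rewrite -scalerDl scaler_eq0 -mulr2n mulrn_eq0 /= !mulf_eq0 invr_eq0 normr_eq0.
  by rewrite (negPf a0) (negPf (q0 t It)) => /eqP.
exists (a * `|q t0| / q t0) => t It.
by rewrite (is_derive0_cst iI hI It0 It) mulfVK // q0.
Qed.

(** * Tangent spaces of the space forms *)

(** This coefficient lets one formula describe the three models: the position
    vector is normal to the hyperquadrics and plays no such part in R^3. *)
Definition curved (R : realType) (M : model) : R :=
  if M is Euclid then 0 else 1.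

Section InnerProduct.
Context {R : realType} {M : model}.
Implicit Types u v w x : ambient R M.

Lemma signature_neq0 (i : 'I_(pred_dim M).+1) : signature i != 0 :> R.
Proof.
rewrite /signature; case: M i => i; rewrite ?oner_eq0 //.
by case: ifP; rewrite ?oppr_eq0 oner_eq0.
Qed.

Lemma ipC u v : ip u v = ip v u.
Proof. by apply: eq_bigr => i _; rewrite mulrAC. Qed.

Lemma ipDl u v w : ip (u + v) w = ip u w + ip v w.
Proof.
by rewrite -big_split; apply: eq_bigr => i _; rewrite mxE mulrDr mulrDl.
Qed.

Lemma ipZl (a : R) u v : ip (a *: u) v = a * ip u v.
Proof. by rewrite mulr_sumr; apply: eq_bigr => i _; rewrite mxE; ring. Qed.

Lemma ipNl u v : ip (- u) v = - ip u v.
Proof. by rewrite -scaleN1r ipZl mulN1r. Qed.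

Lemma ipDr u v w : ip u (v + w) = ip u v + ip u w.
Proof. by rewrite ipC ipDl !(ipC _ u). Qed.

Lemma ipZr (a : R) u v : ip u (a *: v) = a * ip u v.
Proof. by rewrite ipC ipZl ipC. Qed.

Lemma ipNr u v : ip u (- v) = - ip u v.
Proof. by rewrite ipC ipNl ipC. Qed.

Lemma ip0l u : ip 0 u = 0.
Proof. by rewrite -(scale0r 0) ipZl mul0r. Qed.

Definition ipE := (ipDl, ipDr, ipZl, ipZr, ipNl, ipNr).

Lemma is_derive_ip (U V : R -> ambient R M) (t : R) (dU dV : ambient R M) :
  is_derive t 1 U dU -> is_derive t 1 V dV ->
  is_derive t 1 (fun s => ip (U s) (V s)) (ip dU (V t) + ip (U t) dV).
Proof.
move=> /is_derive_mxP Ut /is_derive_mxP Vt.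
rewrite (_ : (fun s => _) = \sum_(i < (pred_dim M).+1)
    (signature i \*: ((fun s => U s 0 i) * (fun s => V s 0 i)))); last first.
  by apply/funext => s; rewrite fct_sumE; apply: eq_bigr => i _; rewrite -mulrA.
rewrite /ip -big_split /=; apply: is_derive_sum => i.
have Ui := Ut 0 i; have Vi := Vt 0 i; apply: is_derive_eq.
rewrite -[LHS]/(signature i * (U t 0 i * dV 0 i + V t 0 i * dU 0 i)); ring.
Qed.

(** [\det A != 0] makes [u], rescaled by the signature, orthogonal to all
    vectors for the standard inner product; the signature has no zero. *)
Lemma ip_nondegenerate (A : 'M[R]_((pred_dim M).+1)) u :
  \det A != 0 -> (forall i, ip u (row i A) = 0) -> u = 0.
Proof.
move=> detA uA; pose su : ambient R M := \row_i (signature i * u 0 i).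
have Au : A^T \in unitmx by rewrite unitmxE det_tr unitfE.
have su0 : su = 0.
  apply: (can_inj (mulmxK Au)); rewrite mul0mx; apply/rowP => i.
  rewrite !mxE -[RHS](uA i); apply: eq_bigr => j _; by rewrite !mxE.
apply/rowP => i; rewrite mxE; have /eqP := congr1 (fun w => w 0 i) su0.
rewrite !mxE mulf_eq0 => /orP[|/eqP//].
by rewrite (negPf (signature_neq0 i)).
Qed.

Lemma tangentE x v : tangent x v <-> curved R M * ip x v = 0.
Proof.
rewrite /curved; case: M x v => x v /=; rewrite ?mul1r //.
by rewrite mul0r; split.
Qed.

Lemma tangent_projE x v :
  tangent_proj x v = v - (curved R M * ip v x / ip x x) *: x.
Proof.
rewrite /curved; case: M x v => x v /=; rewrite ?mul1r //.
by rewrite !mul0r scale0r subr0.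
Qed.

Lemma tangent_proj_linear x (a : R) u v :
  tangent_proj x (a *: u + v) = a *: tangent_proj x u + tangent_proj x v.
Proof.
rewrite !tangent_projE !ipE scalerBr addrACA -opprD scalerA -scalerDl.
by congr (_ - _ *: _); ring.
Qed.

Lemma tangent_linear x (a : R) u v :
  tangent x u -> tangent x v -> tangent x (a *: u + v).
Proof.
move=> /tangentE xu /tangentE xv; apply/tangentE.
by rewrite !ipE mulrDr mulrCA xu xv mulr0 addr0.
Qed.

Lemma tangent_proj_id x v : tangent x v -> tangent_proj x v = v.
Proof.
by move=> /tangentE xv; rewrite tangent_projE ipC xv mul0r scale0r subr0.
Qed.

Lemma ip_tangent_proj x v w : tangent x w -> ip (tangent_proj x v) w = ip v w.
Proof.
move=> /tangentE xw; rewrite tangent_projE !ipE.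
have -> : curved R M * ip v x / ip x x * ip x w
  = ip v x / ip x x * (curved R M * ip x w) by ring.
by rewrite xw mulr0 subr0.
Qed.

End InnerProduct.

Section Frames.
Context {R : realType} {M : model}.
Implicit Types u x : ambient R M.

(** In the hyperquadrics the position vector completes the frame to a basis of
    the ambient space, and a tangent vector is orthogonal to it. *)
Lemma tangent_nondegenerate x (e1 e2 e3 : ambient R M) u :
  positively_oriented x e1 e2 e3 -> tangent x u ->
  ip u e1 = 0 -> ip u e2 = 0 -> ip u e3 = 0 -> u = 0.
Proof.
case: M x e1 e2 e3 u => x e1 e2 e3 u /lt0r_neq0 detA xu u1 u2 u3.
- apply: (@ip_nondegenerate R Euclid _ _ detA) => i; rewrite rowK.
  by case: i => [[|[|[|]]]].
- apply: (@ip_nondegenerate R Sphere _ _ detA) => i; rewrite rowK.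
  by case: i => [[|[|[|[|]]]]] //= _; rewrite ipC.
- apply: (@ip_nondegenerate R Hyperboloid _ _ detA) => i; rewrite rowK.
  by case: i => [[|[|[|[|]]]]] //= _; rewrite ipC.
Qed.

Lemma orthonormal_decomposition x (e1 e2 e3 : ambient R M) u :
  positively_oriented x e1 e2 e3 -> Defs.orthonormal e1 e2 e3 ->
  tangent x e1 -> tangent x e2 -> tangent x e3 -> tangent x u ->
  u = ip u e1 *: e1 + (ip u e2 *: e2 + ip u e3 *: e3).
Proof.
move=> pos [[e11 e22 e33] [e12 e13 e23]] t1 t2 t3 tu.
apply/eqP; rewrite -subr_eq0; apply/eqP; apply: (tangent_nondegenerate pos).
- rewrite -[_ - _]addr0 (_ : u - _ + 0 = - ip u e1 *: e1 +
    (- ip u e2 *: e2 + (- ip u e3 *: e3 + u))).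
    by do 3 (apply: tangent_linear => //).
  by rewrite addr0 !scaleNr !opprD addrC -!addrA.
- by rewrite !ipE e11 (ipC e2) e12 (ipC e3) e13; ring.
- by rewrite !ipE e12 e22 (ipC e3) e23; ring.
- by rewrite !ipE e13 e23 e33; ring.
Qed.

End Frames.

(** * Fields along a Frenet curve *)

Section Curves.
Context {R : realType} {M : model} (c : R) (I : set R).
Context (gamma T N B : R -> ambient R M) (kappa tau : R -> R).
Context (c_gt0 : 0 < c).
Context (I_itv : open_interval I).
Context (gammaM : curve_in c I gamma).
Context (frenet : frenet_apparatus I gamma T N B kappa tau).
Context (tau_neq0 : forall t, I t -> tau t != 0).
Implicit Types (V : R -> ambient R M) (t : R) (m : ambient R M).

Let I_open : open I. Proof. by case: I_itv. Qed.
Let fT : field_along I gamma T. Proof. by case: frenet => -[]. Qed.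
Let fN : field_along I gamma N. Proof. by case: frenet => -[]. Qed.
Let fB : field_along I gamma B. Proof. by case: frenet => -[]. Qed.

(** In R^3 both sides vanish, so that any nonzero [K] will do. *)
Lemma space_form_norm : exists2 K : R, K != 0 &
  forall x : ambient R M, space_form c x -> curved R M * ip x x = curved R M * K.
Proof.
rewrite /curved; exists (match M with
    Euclid => 1 | Sphere => c ^+ 2 | Hyperboloid => - c ^+ 2 end).
  by case: (M); rewrite ?oner_eq0 ?oppr_eq0 ?expf_neq0 ?gt_eqF.
by case: (M) => x /=; rewrite ?mul0r // => -[->].
Qed.

Lemma smooth_is_derive V t : smooth_on I V -> I t ->
  is_derive t 1 V (derive1 V t).
Proof. by move=> sV It; rewrite derive1E; apply/derivableP/(sV 0%N). Qed.

Lemma velocity t : I t -> is_derive t 1 gamma (T t).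
Proof.
move=> It; have [_ /(_ t It)[[-> _ _] _]] := frenet.
by apply: smooth_is_derive => //; case: gammaM.
Qed.

Lemma is_derive_curved_ip V t : smooth_on I V -> I t ->
  (forall s, I s -> tangent (gamma s) (V s)) ->
  curved R M * ip (derive1 V t) (gamma t) = - (curved R M * ip (V t) (T t)).
Proof.
move=> sV It tV; apply/eqP; rewrite -addr_eq0 -mulrDr; apply/eqP.
have dVg := is_derive_ip (smooth_is_derive sV It) (velocity It).
apply: (derive_cst_on I_open It (w := 0)) (is_deriveZ (curved R M) dVg) => s Is /=.
by have /tangentE := tV s Is; rewrite ipC.
Qed.

(** Metric compatibility of the Levi-Civita connection. *)
Lemma covd_compatible U V t :
  field_along I gamma U -> field_along I gamma V -> I t ->
  is_derive t 1 (fun s => ip (U s) (V s))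
    (ip (covd gamma U t) (V t) + ip (U t) (covd gamma V t)).
Proof.
move=> [sU tU] [sV tV] It.
have := is_derive_ip (smooth_is_derive sU It) (smooth_is_derive sV It).
rewrite /covd (ip_tangent_proj _ (tV t It)) (ipC (U t)) (ipC (U t)).
by rewrite (ip_tangent_proj _ (tU t It)).
Qed.

(** The second fundamental form of a hyperquadric is a multiple of the metric
    times the position vector, so it vanishes on the pair [(T, V)]. *)
Lemma derive_normal_field V t : field_along I gamma V -> I t ->
  ip (V t) (T t) = 0 -> is_derive t 1 V (covd gamma V t).
Proof.
move=> [sV tV] It VT; have := smooth_is_derive sV It.
rewrite /covd tangent_projE (is_derive_curved_ip sV It tV) VT.
by rewrite mulr0 oppr0 mul0r scale0r subr0.
Qed.

Lemma frame_components V (f : R -> R) : field_along I gamma V ->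
  (forall t, I t -> covd gamma V t = f t *: T t) -> forall t, I t ->
  [/\ is_derive t 1 (fun s => ip (V s) (T s)) (f t + kappa t * ip (V t) (N t)),
      is_derive t 1 (fun s => ip (V s) (N s))
        (tau t * ip (V t) (B t) - kappa t * ip (V t) (T t)) &
      is_derive t 1 (fun s => ip (V s) (B s)) (- (tau t * ip (V t) (N t)))].
Proof.
move=> fV dV t It; have [_ /(_ t It)] := frenet.
move=> [[_ [[TT NN BB] [TN TB NB]] _] [_ dT dN dB]].
by split; [have := covd_compatible fV fT It | have := covd_compatible fV fN It
  | have := covd_compatible fV fB It]; rewrite dV // ?dT ?dN ?dB !ipE ?TT ?TN ?TB;
  move=> h; apply: (is_derive_eq h); ring.
Qed.

Lemma frame_decomposition V t : field_along I gamma V -> I t ->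
  V t = ip (V t) (T t) *: T t + (ip (V t) (N t) *: N t + ip (V t) (B t) *: B t).
Proof.
move=> [_ tV] It; have [_ /(_ t It)[[_ on pos] _]] := frenet.
by apply: (orthonormal_decomposition pos on) => //;
  [case: fT|case: fN|case: fB|] => [_ h|_ h|_ h|]; [exact: h..|exact: tV].
Qed.

Lemma normal_norm V t : field_along I gamma V -> I t ->
  ip (V t) (T t) = 0 ->
  ip (V t) (V t) = ip (V t) (N t) ^+ 2 + ip (V t) (B t) ^+ 2.
Proof.
move=> fV It VT; rewrite {2}(frame_decomposition fV It) VT scale0r add0r !ipE.
by rewrite -!expr2.
Qed.

(** For a normal field the last two equations say that it is parallel in the
    normal bundle: its components rotate, whatever [f] is.  The component along
    [T], being zero, has zero derivative [f + kappa p]. *)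
Lemma normal_concircular V (f : R -> R) : field_along I gamma V ->
  (forall t, I t -> covd gamma V t = f t *: T t) ->
  (forall t, I t -> ip (V t) (T t) = 0) -> forall t, I t ->
  [/\ f t = - (kappa t * ip (V t) (N t)),
      is_derive t 1 (fun s => ip (V s) (N s)) (tau t * ip (V t) (B t)) &
      is_derive t 1 (fun s => ip (V s) (B s)) (- (tau t * ip (V t) (N t)))].
Proof.
move=> fV dV VT t It; have [dVT dVN dVB] := frame_components fV dV It.
split=> //; last by move: dVN; rewrite VT // mulr0 subr0.
by apply/eqP; rewrite -addr_eq0; apply/eqP/(derive_cst_on I_open It VT dVT).
Qed.

(** Here [0 = - kappa p] kills the component along [N], and then
    [0 = p' = tau q] kills the one along [B]. *)
Lemma normal_parallel_eq0 V : field_along I gamma V ->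
  (forall t, I t -> covd gamma V t = 0) ->
  (forall t, I t -> ip (V t) (T t) = 0) -> forall t, I t -> V t = 0.
Proof.
move=> fV dV VT; have dV0 t : I t -> covd gamma V t = (fun=> 0) t *: T t.
  by move=> It; rewrite dV // scale0r.
have VN t : I t -> ip (V t) (N t) = 0.
  move=> It; have [/esym/eqP + _ _] := normal_concircular fV dV0 VT It.
  rewrite oppr_eq0 mulf_eq0 => /orP[|/eqP//].
  by have [_ /(_ t It)[_ [/lt0r_neq0/negPf -> _ _ _]]] := frenet.
move=> t It; have [_ dVN _] := normal_concircular fV dV0 VT It.
have /eqP := derive_cst_on I_open It VN dVN.
rewrite mulf_eq0 (negPf (tau_neq0 It)) /= => /eqP VB.
by rewrite (frame_decomposition fV It) VT // VN // VB !scale0r !addr0.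
Qed.

Lemma affine_field (alpha : R) m :
  (forall t, I t -> tangent (gamma t) (alpha *: gamma t + m)) ->
  field_along I gamma (fun t => alpha *: gamma t + m) /\
  forall t, I t ->
    covd gamma (fun t => alpha *: gamma t + m) t = alpha *: T t.
Proof.
move=> tP; split; first by split=> //; apply: smooth_on_affine; case: gammaM.
move=> t It; have dg := velocity It.
have dP : is_derive t 1 (alpha \*: gamma + cst m) (alpha *: T t).
  by apply: is_derive_eq; rewrite addr0.
rewrite /covd derive1E (@derive_val _ _ _ _ _ _ _ dP).
(* The zero vector brings the scaling into the shape [a *: u + v]. *)
rewrite -[_ *: _]addr0; set z := 0.
have tz : tangent (gamma t) z by apply/tangentE; rewrite ipC ip0l mulr0.
by rewrite tangent_proj_linear !tangent_proj_id //; case: fT => _; apply.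
Qed.

(** * From spheres to concircular fields *)

Definition unit_concircular_tan V (a b : R) : Prop :=
  let theta := fun t => acos (ip (V t) (N t)) in
  [/\ forall t, I t -> cos (theta t) != 0 /\ a * tan (theta t) + b != 0,
      unit_along I V &
      concircular I gamma V (fun t => 1 / (a * tan (theta t) + b))].

Lemma unit_sum_bound (x y : R) : 1 = x ^+ 2 + y ^+ 2 -> -1 <= x <= 1.
Proof.
move=> xy; rewrite -ler_norml -[leRHS]normr1 -ler_sqr ?nnegrE //.
by rewrite !real_normK ?num_real // expr1n xy lerDl sqr_ge0.
Qed.

Lemma unit_affine_concircular (alpha : R) m :
  let P := fun t => alpha *: gamma t + m in
  alpha != 0 -> (forall t, I t -> tangent (gamma t) (P t)) ->
  (forall t, I t -> ip (P t) (T t) = 0) ->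
  (forall t, I t -> ip (P t) (P t) = 1) ->
  unit_concircular_tan P 0 alpha^-1.
Proof.
move=> P alpha0 tP PT PP; have [fP dP] := affine_field tP.
have fE : (fun t => 1 / (0 * tan (acos (ip (P t) (N t))) + alpha^-1)) = cst alpha.
  by apply/funext => t; rewrite mul0r add0r div1r invrK.
split=> [t It||]; first last.
- rewrite fE; split=> [//||t It]; first exact: smooth_on_cst.
  have [_ /(_ t It)[[<- _ _] _]] := frenet; exact: dP.
- exact: PP.
rewrite mul0r add0r invr_eq0; split=> //.
have := normal_norm fP It (PT t It); rewrite PP // => /unit_sum_bound PNle1.
rewrite acosK ?in_itv //=; apply/eqP => PN0.
have [/eqP + _ _] := normal_concircular fP dP PT It.
by rewrite PN0 mulr0 oppr0 (negPf alpha0).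
Qed.

Lemma affine_concircular (alpha : R) m :
  let P := fun t => alpha *: gamma t + m in
  alpha != 0 -> (forall t, I t -> tangent (gamma t) (P t)) ->
  (forall t, I t -> ip (P t) (T t) = 0) ->
  exists V a b, unit_concircular_tan V a b.
Proof.
move=> P alpha0 tP PT; have [fP dP] := affine_field tP.
have [t0 It0] : I !=set0 by case: I_itv.
have [s PPs] : exists s, forall t, I t -> ip (P t) (P t) = s.
  exists (ip (P t0) (P t0)) => t It; case: I_itv => _ iI _.
  apply: (is_derive0_cst (f := fun t => ip (P t) (P t)) iI) => // x Ix.
  have := covd_compatible fP fP Ix.
  by rewrite dP // ipZl ipZr (ipC (T x)) PT // mulr0 addr0.
have s_gt0 : 0 < s.
  rewrite -(PPs t0 It0) (normal_norm fP It0 (PT t0 It0)) ltr_pwDl ?sqr_ge0 //.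
  rewrite exprn_even_gt0 //=; apply/eqP => PN0.
  have [/eqP + _ _] := normal_concircular fP dP PT It0.
  by rewrite PN0 mulr0 oppr0 (negPf alpha0).
pose r := Num.sqrt s; have r_gt0 : 0 < r by rewrite sqrtr_gt0.
have PE t : (r^-1 * alpha) *: gamma t + r^-1 *: m = r^-1 *: P t.
  by rewrite scalerDr scalerA.
exists (fun t => (r^-1 * alpha) *: gamma t + r^-1 *: m), 0, (r^-1 * alpha)^-1.
apply: unit_affine_concircular => [|t It|t It|t It]; rewrite ?PE.
- by rewrite mulf_neq0 // invr_neq0 // gt_eqF.
- by have /tangentE h := tP t It; apply/tangentE; rewrite ipZr mulrCA h mulr0.
- by rewrite ipZl PT // mulr0.
- rewrite ipZl ipZr PPs // -(sqr_sqrtr (ltW s_gt0)) -/r expr2 mulKf ?gt_eqF //.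
  by rewrite mulVf // gt_eqF.
Qed.

(** The field is the tangential part [m - (d / <gamma, gamma>) gamma] of [m].
    If [d] were zero, [m] itself would be a parallel tangent field normal to
    the curve, contrary to [normal_parallel_eq0]. *)
Lemma hyperplane_section_field m (d : R) : curved R M = 1 -> m != 0 ->
  (forall t, I t -> ip m (gamma t) = d) ->
  exists alpha, [/\ alpha != 0,
    forall t, I t -> tangent (gamma t) (alpha *: gamma t + m) &
    forall t, I t -> ip (alpha *: gamma t + m) (T t) = 0].
Proof.
move=> M1 m0 mg.
have [K K0 gK] : exists2 K, K != 0 & forall t, I t -> ip (gamma t) (gamma t) = K.
  have [K K0 gK] := space_form_norm; exists K => // t It.
  by have := gK _ (gammaM.2 t It); rewrite M1 !mul1r.
have gT t : I t -> ip (gamma t) (T t) = 0.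
  by move=> It; have /tangentE := fT.2 t It; rewrite M1 mul1r.
have mT t : I t -> ip m (T t) = 0.
  move=> It; have dm : is_derive t 1 (cst m : R -> _) 0 by exact: is_derive_cst.
  have := derive_cst_on I_open It mg (is_derive_ip dm (velocity It)).
  by rewrite ip0l add0r.
exists (- (d / K)); split=> [|t It|t It].
- rewrite oppr_eq0 mulf_neq0 ?invr_neq0 //; apply: contra_neq m0 => d0.
  have tm t : I t -> tangent (gamma t) (0 *: gamma t + m).
    move=> It; apply/tangentE; rewrite !ipE (ipC _ m) mg // d0.
    by rewrite mul0r addr0 mulr0.
  have [fm dm] := affine_field tm; have [t0 It0] : I !=set0 by case: I_itv.
  have := normal_parallel_eq0 fm _ _ It0; rewrite scale0r add0r; apply=> t It.
    by rewrite dm // scale0r.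
  by rewrite !ipE mT // mul0r addr0.
- apply/tangentE; rewrite !ipE gK // (ipC _ m) mg //.
  by rewrite mulNr divfK // addNr mulr0.
- by rewrite !ipE gT // mT // mulr0 addr0.
Qed.

Lemma concircular_of_sphere (S : set (ambient R M)) :
  geodesic_sphere c S -> (forall t, I t -> S (gamma t)) ->
  exists V a b, unit_concircular_tan V a b.
Proof.
move=> sS gS; suff [alpha [m [alpha0 tP PT]]] : exists alpha m, [/\ alpha != 0,
    forall t, I t -> tangent (gamma t) (alpha *: gamma t + m) &
    forall t, I t -> ip (alpha *: gamma t + m) (T t) = 0].
  exact: affine_concircular alpha0 tP PT.
have [[m [r gm]]|[M1 [m [d [m0 mg]]]]] :
  (exists m r, curved R M = 0 /\ forall t, I t ->
     ip (gamma t - m) (gamma t - m) = r) \/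
  (curved R M = 1 /\ exists m d, m != 0 /\ forall t, I t -> ip m (gamma t) = d).
- rewrite /curved; case: (M) S gamma sS gS => S g.
  + move=> [m [r [_ ->]]] gS; left; exists m, (r ^+ 2); by split.
  + move=> [m [d [m0 -> _]]] gS; right; split=> //; exists m, d; split=> // t.
    by case/gS.
  + move=> [m [d [m0 -> _]]] gS; right; split=> //; exists m, d; split=> // t.
    by case/gS.
- case: gm => M0 gm; exists (-1), m; split=> [|t It|t It].
  + by rewrite oppr_eq0 oner_eq0.
  + by apply/tangentE; rewrite M0 mul0r.
  + have dgm : is_derive t 1 (gamma - cst m) (T t).
      by have dg := velocity It; apply: is_derive_eq; rewrite subr0.
    have /eqP := derive_cst_on I_open It gm (is_derive_ip dgm dgm).
    rewrite [(gamma - cst m) t]/= ipC -mulr2n mulrn_eq0 /=.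
    by rewrite -oppr_eq0 -ipNl opprB -scaleN1r addrC => /eqP.
- have [alpha H] := hyperplane_section_field M1 m0 mg.
  by exists alpha, m.
Qed.

(** * From concircular fields to spheres *)

Lemma curve_not_cst t : I t -> exists2 s, I s & gamma s <> gamma t.
Proof.
move=> It; apply: contrapT => gcst.
have gE s : I s -> gamma s = gamma t.
  by move=> Is; apply: contrapT => ne; apply: gcst; exists s.
have [_ /(_ t It)[[_ [[TT _ _] _] _] _]] := frenet; move/eqP: TT.
by rewrite (derive_cst_on I_open It gE (velocity It)) ip0l eq_sym oner_eq0.
Qed.

(** The vector [m = W + gamma] is constant.  In R^3 the length of [W] is
    constant because [W] is normal to [T], so [m] is the centre; in the
    hyperquadrics [W] is orthogonal to [gamma], so
    [<m, gamma> = <gamma, gamma>] is a nonzero constant, and in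
    particular [m] is nonzero. *)
Lemma sphere_of_center (W : R -> ambient R M) :
  (forall t, I t -> is_derive t 1 W (- T t)) ->
  (forall t, I t -> tangent (gamma t) (W t)) ->
  (forall t, I t -> ip (W t) (T t) = 0) ->
  (forall t, I t -> 0 < ip (W t) (W t)) ->
  exists S : set (ambient R M),
    geodesic_sphere c S /\ forall t, I t -> S (gamma t).
Proof.
move=> dW tW WT W_gt0; have [_ iI [t0 It0]] := I_itv.
have [m mE] : exists m, forall t, I t -> W t = m - gamma t.
  exists (W t0 + gamma t0) => t It.
  apply/eqP; rewrite -subr_eq opprK; apply/eqP.
  apply: (is_derive0_cst_mx (F := W + gamma) iI) => // s Is.
  have dWs := dW s Is; have dgs := velocity Is.
  by apply: is_derive_eq; rewrite addNr.
have WW t : I t -> ip (W t) (W t) = ip (W t0) (W t0).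
  move=> It; apply: (is_derive0_cst (f := fun t => ip (W t) (W t)) iI) => // s Is.
  have dWs := is_derive_ip (dW s Is) (dW s Is); apply: (is_derive_eq dWs).
  by rewrite ipNl ipNr (ipC (T s)) WT // oppr0 addr0.
have [r r0 gmr] : exists2 r, 0 < r &
    forall t, I t -> ip (gamma t - m) (gamma t - m) = r.
  exists (ip (W t0) (W t0)) => [|t It]; first exact: W_gt0.
  by rewrite -(WW t It) mE // -opprB ipNl ipNr opprK.
have [s Is gs] := curve_not_cst It0.
have [K K0 gK] := space_form_norm.
have gM t : I t -> space_form c (gamma t) by case: gammaM => _; exact.
have mg t : I t -> curved R M * ip m (gamma t) = curved R M * K.
  move=> It; have /tangentE := tW t It; rewrite mE // ipDr ipNr mulrBr.
  by rewrite (gK _ (gM t It)) (ipC m) => /eqP; rewrite subr_eq0 => /eqP.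
have m0 : curved R M = 1 -> m != 0.
  move=> M1; apply: contra_neq K0 => m0; have := mg _ It0.
  by rewrite M1 !mul1r m0 ip0l.
have plane : curved R M = 1 -> exists p d, [/\ p != 0,
    forall t, I t -> (space_form c `&` [set x | ip p x = d]) (gamma t) &
    exists x y, [/\ (space_form c `&` [set x | ip p x = d]) x,
      (space_form c `&` [set x | ip p x = d]) y & x <> y]].
  move=> M1; have mK t : I t -> ip m (gamma t) = K.
    by move=> It; have := mg t It; rewrite M1 !mul1r.
  exists m, K; split; [exact: m0|by move=> t It; split; [exact: gM|exact: mK]|].
  by exists (gamma s), (gamma t0); do ?[split=> //]; rewrite /= ?mK //; exact: gM.
move: r0 gmr plane; rewrite /curved; clear.
case: M gamma m => g m r0 gmr plane.
- exists [set x | ip (x - m) (x - m) = Num.sqrt r ^+ 2]; split.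
    by exists m, (Num.sqrt r); rewrite sqrtr_gt0.
  by move=> t It /=; rewrite sqr_sqrtr ?ltW // gmr.
- have [p [d [p0 gS S2]]] := plane erefl.
  by exists (space_form c `&` [set x | ip p x = d]); split=> //; exists p, d.
- have [p [d [p0 gS S2]]] := plane erefl.
  by exists (space_form c `&` [set x | ip p x = d]); split=> //; exists p, d.
Qed.

Lemma sphere_of_concircular V (a b : R) :
  unit_concircular_tan V a b ->
  exists S : set (ambient R M),
    geodesic_sphere c S /\ forall t, I t -> S (gamma t).
Proof.
set theta := fun t => acos (ip (V t) (N t)).
set f := fun t => 1 / (a * tan (theta t) + b).
move=> [/= theta_ok V1 [fV sf dV']].
have dV t : I t -> covd gamma V t = f t *: T t.
  by move=> It; have [_ /(_ t It)[[-> _ _] _]] := frenet; exact: dV'.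
have f0 t : I t -> f t != 0.
  by move=> It; rewrite /f div1r invr_neq0 //; case: (theta_ok t It).
have VT t : I t -> ip (V t) (T t) = 0.
  move=> It; have /eqP := derive_cst_on I_open It V1 (covd_compatible fV fV It).
  rewrite (ipC (V t)) -mulr2n mulrn_eq0 /= dV // ipZl mulf_eq0 (negPf (f0 t It)).
  by rewrite ipC => /eqP.
pose p t := ip (V t) (N t); pose q t := ip (V t) (B t).
have fE t : I t -> f t = - (kappa t * p t).
  by case/(normal_concircular fV dV VT).
have dp t : I t -> is_derive t 1 p (tau t * q t).
  by case/(normal_concircular fV dV VT).
have dq t : I t -> is_derive t 1 q (- (tau t * p t)).
  by case/(normal_concircular fV dV VT).
have pq t : I t -> 1 = p t ^+ 2 + q t ^+ 2.
  by move=> It; rewrite -(normal_norm fV It (VT t It)) V1.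
have p0 t : I t -> p t != 0.
  by move=> It; apply: contra_neq (f0 t It) => pt; rewrite fE // pt mulr0 oppr0.
have tanE t : I t -> tan (theta t) = `|q t| / p t.
  move=> It; have ple1 := unit_sum_bound (pq t It).
  rewrite /tan /theta sin_acos // acosK ?in_itv //=; congr (_ / _).
  by rewrite (pq t It) addrC addKr sqrtr_sqr.
have aqE t : I t -> a * `|q t| = ((f t)^-1 - b) * p t.
  move=> It; rewrite /f div1r invrK tanE //; field; exact: p0.
have daq t : I t -> derivable (fun s => a * `|q s|) t 1.
  move=> It; apply: (near_eq_derivable (f := ((fun s => (f s)^-1) - cst b) * p)).
    by apply: near_open It _ => // s Is; rewrite aqE.
  apply: derivableM; last by case: (dp t It).
  apply: derivableB; last exact: derivable_cst.
  by apply: derivableV; [exact: f0|exact: (sf 0%N t It)].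
have [h hE] : exists h, forall t, I t -> a * `|q t| = h * q t.
  apply: norm_eq_cst_mul dq _ daq => // t It.
  by rewrite oppr_eq0 mulf_neq0 // ?tau_neq0 // p0.
(* [rho] is the radius of curvature; [sigma] is [rho' / tau]. *)
pose rho t := - (h * q t + b * p t); pose sigma t := h * p t - b * q t.
have kr t : I t -> kappa t * rho t = 1.
  move=> It; have k0 : kappa t != 0.
    by have [_ /(_ t It)[_ [/lt0r_neq0]]] := frenet.
  rewrite /rho -hE // aqE // fE //; field.
  by rewrite k0 p0.
have dr t : I t -> is_derive t 1 rho (tau t * sigma t).
  move=> It; have dpt := dp t It; have dqt := dq t It.
  rewrite (_ : rho = - (h \*: q + b \*: p)) //; apply: is_derive_eq.
  rewrite -[LHS]/(- (h * (- (tau t * p t)) + b * (tau t * q t))) /sigma; ring.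
have ds t : I t -> is_derive t 1 sigma (- (tau t * rho t)).
  move=> It; have dpt := dp t It; have dqt := dq t It.
  rewrite (_ : sigma = h \*: p - b \*: q) //; apply: is_derive_eq.
  rewrite -[LHS]/(h * (tau t * q t) - b * (- (tau t * p t))) /rho; ring.
have frame t : I t -> [/\ ip (N t) (T t) = 0, ip (B t) (T t) = 0,
   ip (N t) (N t) = 1, ip (B t) (B t) = 1 & ip (N t) (B t) = 0].
  move=> It; have [_ /(_ t It)[[_ [[_ NN BB] [TN TB NB]] _] _]] := frenet.
  by rewrite (ipC _ (T t)) (ipC _ (T t)).
apply: (sphere_of_center (W := fun t => rho t *: N t + sigma t *: B t)) => t It.
- have [NT BT _ _ _] := frame t It.
  have [_ /(_ t It)[_ [_ _ dN dB]]] := frenet.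
  have dNt := is_derive_scale (dr t It) (derive_normal_field fN It NT).
  have dBt := is_derive_scale (ds t It) (derive_normal_field fB It BT).
  have dW := is_deriveD dNt dBt; apply: (is_derive_eq dW).
  rewrite dN dB -[RHS]scaleN1r -(kr t It) !scalerDr !scalerA.
  apply/rowP => i; rewrite !mxE; ring.
- have tN := fN.2 t It; have /tangentE tB := fB.2 t It.
  by apply: tangent_linear => //; apply/tangentE; rewrite ipZr mulrCA tB mulr0.
- by have [NT BT _ _ _] := frame t It; rewrite ipDl !ipZl NT BT !mulr0 addr0.
- have [_ _ NN BB NB] := frame t It.
  rewrite !(ipDl, ipDr, ipZl, ipZr) NN BB NB (ipC _ (N t)) NB !mulr0 !mulr1.
  rewrite addr0 add0r -!expr2 ltr_pwDl ?sqr_ge0 // exprn_even_gt0 //=.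
  by apply/eqP => r0; have /eqP := kr t It; rewrite r0 mulr0 eq_sym oner_eq0.
Qed.

End Curves.

Unset Implicit Arguments.

Theorem theorem3p10 (R : realType) (M : model) (c : R) (hc : 0 < c)
    (I : set R) (hI : open_interval I)
    (gamma T N B : R -> ambient R M) (kappa tau : R -> R)
    (hgamma : frenet_curve c I gamma)
    (harc : arc_length I gamma)
    (hframe : frenet_apparatus I gamma T N B kappa tau)
    (htau : forall t, I t -> tau t != 0) :
  (exists S : set (ambient R M),
     geodesic_sphere c S /\ forall t, I t -> S (gamma t))
  <->
  (exists (V : R -> ambient R M) (a b : R),
     let theta := fun t => acos (ip (V t) (N t)) in
     [/\ forall t, I t -> cos (theta t) != 0 /\ a * tan (theta t) + b != 0,
         unit_along I V &
         concircular I gamma V (fun t => 1 / (a * tan (theta t) + b))]).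
Proof.
split=> [[S [sS gS]]|[V [a [b Vab]]]].
  exact: (concircular_of_sphere hc hI (proj1 hgamma) hframe htau sS gS).
exact: (sphere_of_concircular hc hI (proj1 hgamma) hframe htau Vab).
Qed.
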